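(* Let $n,k\ge 1$ and $m\ge 0$ be integers and let $B\in\{B^{-}_{n,k},B^{\circ}_{n,k}\}$. The number of ways to place $m$ non-attacking rooks on the board $B$ is $$\sum_{(a_1,\dots,a_k)\in\mathfrak{C}_m(B)}\ \prod_{i=1}^{k}\binom{n-a_{i-1}}{a_i}(n)_{a_i},$$ where $a_0=0$ if $B=B^{-}_{n,k}$ and $a_0=a_k$ if $B=B^{\circ}_{n,k}$.
   Context: A board is a $k$-tuple $(B^{(1)},\dots,B^{(k)})$ of $n\times n$ chessboards, with rows and columns numbered $1,\dots,n$. On the linear configuration $B^{-}_{n,k}$, two rooks are attacking if they are in the same row or the same column of the same board $B^{(i)}$, or if one is in the $j$th row of $B^{(i-1)}$ and the other is in the $j$th column of $B^{(i)}$ for some $1\le j\le n$ and $2\le i\le k$. On the circular configuration $B^{\circ}_{n,k}$ the rule is the same except that $i$ ranges over $1\le i\le k$ with $B^{(0)}$ identified with $B^{(k)}$. For $B^{\circ}_{n,1}$, a rook in cell $(j,j)$ is considered to attack itself (it is both in row $j$ and in column $j$), so no rook of a non-attacking placement lies on the main diagonal. A set of rooks (at most one per cell) is non-attacking if there is no attack among them; a placement is determined by its set of occupied cells. The composition of a placement of non-attacking rooks is $(a_1,\dots,a_k)$, where $a_i\ge 0$ is the number of rooks on $B^{(i)}$. $\mathfrak{C}_m(B)$ is the set of all compositions of placements of $m$ non-attacking rooks on $B$. $(n)_a=n(n-1)\cdots(n-a+1)$ is the falling factorial, with $(n)_0=1$. *)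

(* Defs.v *)
From mathcomp Require Import all_boot.

Set Implicit Arguments.
Unset Strict Implicit.
Unset Printing Implicit Defensive.

Variant config := Linear | Circular.

(* All indices are 0-based: boards are 0, ..., k-1, rows and columns are
   0, ..., n-1. *)
Definition cell (n k : nat) : finType := ('I_k * ('I_n * 'I_n))%type.

Definition board_of n k (x : cell n k) : 'I_k := x.1.
Definition row_of n k (x : cell n k) : 'I_n := x.2.1.
Definition col_of n k (x : cell n k) : 'I_n := x.2.2.

(* The index i-1 of the board preceding board i. The first board has no
   predecessor in the linear configuration; in the circular one it is preceded
   by the last board ([ord_pred] is cyclic), hence by itself when k = 1. *)
Definition prev_board k (c : config) (i : 'I_k) : option 'I_k :=
  match c with
  | Linear => if i == 0 :> nat then None else Some (ord_pred i)
  | Circular => Some (ord_pred i)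
  end.

Definition same_line n k (x y : cell n k) : bool :=
  (board_of x == board_of y) &&
  ((row_of x == row_of y) || (col_of x == col_of y)).

Definition row_meets_col n k (c : config) (x y : cell n k) : bool :=
  (prev_board c (board_of y) == Some (board_of x)) && (row_of x == col_of y).

(* [x != y] guards only the first disjunct: [row_meets_col c x x] holds exactly
   when the configuration is circular, k = 1 and x is on the main diagonal,
   which is the case where a rook attacks itself. *)
Definition attacking n k (c : config) (x y : cell n k) : bool :=
  [|| (x != y) && same_line x y, row_meets_col c x y | row_meets_col c y x].

Definition nonattacking n k (c : config) (A : {set cell n k}) : bool :=
  [forall x in A, forall y in A, ~~ attacking c x y].

Definition placements n k (c : config) (m : nat) : {set {set cell n k}} :=
  [set A : {set cell n k} | nonattacking c A & #|A| == m].

Definition composition n k (A : {set cell n k}) : {ffun 'I_k -> nat} :=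
  [ffun i => #|[set x in A | board_of x == i]|].

(* The set of compositions, as a duplicate-free sequence. *)
Definition compositions n k (c : config) (m : nat) : seq {ffun 'I_k -> nat} :=
  undup [seq composition A | A in placements n k c m].

(* a_{i-1}, with a_0 = 0 (linear) or a_0 = a_k (circular). *)
Definition prev_part k (c : config) (a : {ffun 'I_k -> nat}) (i : 'I_k) : nat :=
  if prev_board c i is Some j then a j else 0.

(* Main.v *)
Require Import Defs.
From mathcomp Require Import all_boot.

(** On a single board a non-attacking placement is the graph of an injection
    from its set of occupied rows to its columns, and the rule between
    consecutive boards says exactly that the columns used on board [i] avoid the
    rows used on board [i-1].  So fix the sets of occupied rows on all the boards
    first: with row sets [R i] of sizes [a i], the boards no longer interact,
    and board [i] carries an arbitrary injection from [R i] into the complement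
    of [R (i-1)].  There are [(n - a_(i-1)) ^_ (a i)] of these whatever the sets
    are, and ['C(n, a i)] choices of [R i], whence
    ['C(n, a i) * (n - a_(i-1)) ^_ (a i) = 'C(n - a_(i-1), a i) * n ^_ (a i)]
    for each board.  Choosing all the row sets before any column is what makes
    the count uniform: the cyclic dependency of the circular configuration, and
    the self-attacks on its diagonal when [k = 1], need no separate treatment.

    The one-board count is [card_injection_graphs], the translation of the
    attacking rule is [nonattacking_slicesP], and [card_fixed_composition]
    combines them into the product formula. *)

Set Implicit Arguments.
Unset Strict Implicit.
Unset Printing Implicit Defensive.

(** * Counting graphs of injections *)

Section InjectionGraphs.

Variables T U : finType.
Implicit Types (R : {set T}) (D : {set U}) (S : {set T * U}).

Definition line_free S :=
  (#|fst @: S| == #|S|) && (#|snd @: S| == #|S|).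

Definition injection_graphs R D : {set {set T * U}} :=
  [set S : {set T * U} | [&& fst @: S == R, snd @: S \subset D & line_free S]].

Lemma line_freeP S :
  reflect ({in S &, injective fst} /\ {in S &, injective snd}) (line_free S).
Proof.
by apply: (iffP andP) => -[inj1 inj2]; split; apply/imset_injP.
Qed.

Definition graph R (f : {ffun {x | x \in R} -> U}) : {set T * U} :=
  [set (val x, f x) | x : {x | x \in R}].

Lemma mem_graph R (f : {ffun {x | x \in R} -> U}) x y :
  ((val x, y) \in graph f) = (y == f x).
Proof.
apply/imsetP/eqP => [[z _ [/val_inj -> ->]] // | ->]; by exists x.
Qed.

Lemma graph_inj R : injective (@graph R).
Proof.
move=> f g fg; apply/ffunP => x.
by apply/eqP; rewrite -mem_graph -fg mem_graph.
Qed.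

(** Counting is transported from injective finite functions on the subtype of
    elements of [R]: every injection graph over [R] is the graph of a unique
    one. *)
Lemma card_injection_graphs R D : #|injection_graphs R D| = #|D| ^_ #|R|.
Proof.
rewrite -(card_sig (mem R)) -card_inj_ffuns_on -(card_imset _ (@graph_inj R)).
apply: eq_card => S; rewrite inE; apply/idP/imsetP.
- case/and3P=> /eqP defR sSD /line_freeP[inj1 inj2].
  have ex (x : {x | x \in R}) : exists y, (val x, y) \in S.
    by case: x => x /=; rewrite -defR => /imsetP[[x' y] Sxy ->]; exists y.
  pose f := [ffun x => xchoose (ex x)].
  have fP x : (val x, f x) \in S by rewrite ffunE; exact: xchooseP (ex x).
  exists f.
    rewrite inE; apply/andP; split.
      apply/ffun_onP => x; apply: (subsetP sSD).
      by apply/imsetP; exists (val x, f x).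
    apply/injectiveP => x y fxy; apply: val_inj.
    by have [] := inj2 _ _ (fP x) (fP y) fxy.
  apply/setP => -[x y]; apply/idP/imsetP => [Sxy | [z _ ->] //].
  have Rx : x \in R by rewrite -defR; apply/imsetP; exists (x, y).
  exists (Sub x Rx) => //.
  exact: inj1 Sxy (fP (Sub x Rx)) (erefl x).
- case=> f; rewrite inE => /andP[/ffun_onP fD /injectiveP f_inj] ->.
  apply/and3P; split.
  + apply/eqP/setP => x; apply/imsetP/idP => [[_ /imsetP[z _ ->] ->] | Rx].
      exact: valP.
    by exists (x, f (Sub x Rx)) => //; rewrite (mem_graph f (Sub x Rx)).
  + by apply/subsetP => _ /imsetP[_ /imsetP[z _ ->] ->]; apply: fD.
  + apply/line_freeP; split=> _ _ /imsetP[x _ ->] /imsetP[y _ ->] /=.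
      by move/val_inj->.
    by move/f_inj->.
Qed.

End InjectionGraphs.

(** * Placements, board by board *)

Section Slices.

Variables (n k : nat) (c : config).

Definition slices (A : {set cell n k}) : {ffun 'I_k -> {set 'I_n * 'I_n}} :=
  [ffun i => [set p | (i, p) \in A]].

Lemma mem_slices A i p : (p \in slices A i) = ((i, p) \in A).
Proof. by rewrite ffunE inE. Qed.

Lemma slices_bij : bijective slices.
Proof.
exists (fun G : {ffun 'I_k -> {set 'I_n * 'I_n}} =>
          [set x : cell n k | x.2 \in G x.1]) => [A | G].
  by apply/setP => -[i p]; rewrite inE mem_slices.
by apply/ffunP => i; apply/setP => p; rewrite mem_slices inE.
Qed.

Lemma compositionE A i : composition A i = #|slices A i|.
Proof.
rewrite ffunE -(card_imset (slices A i) (f := pair i)); last by move=> p q [].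
apply: eq_card => -[j p]; rewrite inE /board_of /=.
apply/andP/imsetP => [[Ax /eqP <-] | [q]].
  by exists p; rewrite ?mem_slices.
by rewrite mem_slices => Aq [-> ->].
Qed.

Lemma sum_composition (A : {set cell n k}) : \sum_(i < k) composition A i = #|A|.
Proof.
rewrite -sum1_card (partition_big (@board_of n k) predT) //=.
by apply: eq_bigr => i _; rewrite ffunE sum1dep_card.
Qed.

Definition occupied_rows (G : {ffun 'I_k -> {set 'I_n * 'I_n}}) :
    {ffun 'I_k -> {set 'I_n}} :=
  [ffun i => fst @: G i].

Lemma occupied_rowsE G i : occupied_rows G i = fst @: G i.
Proof. exact: ffunE. Qed.

Definition allowed_cols (R : {ffun 'I_k -> {set 'I_n}}) (i : 'I_k) :
    {set 'I_n} :=
  ~: (if prev_board c i is Some j then R j else set0).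

Lemma card_allowed_cols (R : {ffun 'I_k -> {set 'I_n}})
    (a : {ffun 'I_k -> nat}) i :
  (forall j, #|R j| = a j) -> #|allowed_cols R i| = n - prev_part c a i.
Proof.
move=> Ra; rewrite cardsCs setCK card_ord /prev_part.
by case: prev_board => [j|]; rewrite ?Ra ?cards0.
Qed.

(** An attack between two boards involves the earlier one only through its set
    of occupied rows, so once the family [R] of these sets is recorded, being
    non-attacking is a condition on each board separately.  On a circular board
    with [k = 1] the columns must avoid the rows of the board itself, which is
    also what excludes the rooks on the diagonal. *)
Lemma nonattacking_slicesP (A : {set cell n k}) :
  let R := occupied_rows (slices A) in
  reflect (forall i, slices A i \in injection_graphs (R i) (allowed_cols R i))
          (nonattacking c A).
Proof.
move=> R; apply: (iffP idP) => [nA i | GA].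
- have {}nA x y : x \in A -> y \in A -> ~~ attacking c x y.
    by move=> Ax Ay; have /forall_inP/(_ y Ay) := forall_inP nA x Ax.
  rewrite inE occupied_rowsE eqxx /=; apply/andP; split.
    apply/subsetP => _ /imsetP[[r s] Gp ->] /=; rewrite inE.
    case ij: prev_board => [j|]; rewrite ?inE //.
    rewrite occupied_rowsE; apply/imsetP => -[[r' s'] Gq /= rs].
    rewrite !mem_slices in Gp Gq; have := nA _ _ Gq Gp.
    by rewrite /attacking /row_meets_col /= ij rs !eqxx orbT.
  apply/line_freeP; split=> -[r s] [r' s']; rewrite !mem_slices => Gp Gq /= e;
    apply/eqP; have := nA _ _ Gp Gq; rewrite /attacking /same_line /= e;
    rewrite /board_of /row_of /col_of /= !eqxx ?orbT !andbT !negb_or => /andP[];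
    by rewrite negbK xpair_eqE eqxx.
- have no_meet x y : x \in A -> y \in A -> ~~ row_meets_col c x y.
    case: x y => j [r s] [i [r' s']] Ax Ay; apply/negP => /andP[/eqP ij /eqP e].
    rewrite /board_of /row_of /col_of /= in ij e.
    have := GA i; rewrite inE => /and3P[_ /subsetP sub _].
    have /sub : s' \in snd @: slices A i.
      by apply/imsetP; exists (r', s'); rewrite ?mem_slices.
    rewrite inE ij occupied_rowsE => /negP; apply.
    by apply/imsetP; exists (r, s); rewrite ?mem_slices.
  apply/forall_inP => x Ax; apply/forall_inP => y Ay.
  rewrite !negb_or !no_meet // !andbT; apply/negP => /andP[/negP nxy].
  case: x y Ax Ay nxy => i p [j q] Ax Ay nxy /andP[/= /eqP ij pq].
  rewrite /board_of /= in ij; rewrite -{j}ij in Ay nxy pq.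
  apply: nxy; rewrite xpair_eqE eqxx /=; apply/eqP.
  rewrite -mem_slices in Ax; rewrite -mem_slices in Ay.
  have := GA i; rewrite inE => /and3P[_ _ /line_freeP[inj1 inj2]].
  by case/orP: pq => /eqP; [apply: inj1 | apply: inj2].
Qed.

(** With [R] fixed the allowed columns are fixed too, and the placements form a
    product over the boards. *)
Lemma card_fixed_rows (R : {ffun 'I_k -> {set 'I_n}}) (a : {ffun 'I_k -> nat}) :
  (forall i, #|R i| = a i) ->
  #|[set A | nonattacking c A & occupied_rows (slices A) == R]|
    = \prod_(i < k) (n - prev_part c a i) ^_ (a i).
Proof.
move=> Ra.
pose F i : pred _ := mem (injection_graphs (R i) (allowed_cols R i)).
transitivity #|(family F : pred {ffun 'I_k -> {set 'I_n * 'I_n}})|.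
  rewrite -(on_card_preimset (onW_bij _ slices_bij)).
  apply: eq_card => A; rewrite !inE.
  apply/andP/familyP => [[/nonattacking_slicesP nA /eqP defR] i | AF].
    by rewrite /F -defR; apply: nA.
  have defR : occupied_rows (slices A) = R.
    apply/ffunP => i; rewrite occupied_rowsE.
    by have := AF i; rewrite !inE => /andP[/eqP].
  by rewrite defR eqxx; split=> //; apply/nonattacking_slicesP; rewrite defR.
rewrite card_family foldrE big_map big_enum /=.
apply: eq_bigr => i _.
by rewrite card_injection_graphs Ra (card_allowed_cols _ Ra).
Qed.

(** Both sides are ['C(p, a) * 'C(q, a) * a`!]. *)
Lemma bin_ffact_exchange p q a : 'C(q, a) * p ^_ a = 'C(p, a) * q ^_ a.
Proof. by rewrite -!bin_ffact mulnCA. Qed.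

(** The count in [card_fixed_rows] depends on the row sets only through their
    sizes, so summing over the row sets multiplies it by their number. *)
Lemma card_fixed_composition (a : {ffun 'I_k -> nat}) :
  #|[set A : {set cell n k} | nonattacking c A & composition A == a]|
    = \prod_(i < k) ('C(n - prev_part c a i, a i) * n ^_ (a i)).
Proof.
pose sizes_a (R : {ffun 'I_k -> {set 'I_n}}) := [forall i, #|R i| == a i].
rewrite -sum1_card.
rewrite (partition_big (fun A => occupied_rows (slices A)) sizes_a) /=; last first.
  move=> A; rewrite inE => /andP[/nonattacking_slicesP nA /eqP def_a].
  apply/forallP => i; rewrite -def_a compositionE occupied_rowsE.
  by have := nA i; rewrite inE => /and4P[].
transitivity (\sum_(R | sizes_a R) \prod_(i < k) (n - prev_part c a i) ^_ (a i)).
  apply: eq_bigr => R /forallP Ra.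
  rewrite -(@card_fixed_rows R) => [|i]; last exact/eqP.
  rewrite sum1dep_card; apply: eq_card => A; rewrite !inE -andbA.
  apply/and3P/andP => [[-> _ ->] // | [nA /eqP defR]]; rewrite nA defR; split=> //.
  apply/eqP/ffunP => i; rewrite compositionE -(eqP (Ra i)) -defR occupied_rowsE.
  move/nonattacking_slicesP: nA => /(_ i); rewrite inE => /and4P[_ _ cardS _].
  by rewrite (eqP cardS).
rewrite sum_nat_const.
have -> : #|sizes_a| = \prod_(i < k) 'C(n, a i).
  pose F i : pred {set 'I_n} := mem [set B : {set 'I_n} | #|B| == a i].
  transitivity #|(family F : pred {ffun 'I_k -> {set 'I_n}})|.
    apply: eq_card => R; apply/forallP/familyP => RF i;
      by have := RF i; rewrite !inE.
  rewrite card_family foldrE big_map big_enum /=.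
  by apply: eq_bigr => i _; rewrite card_draws card_ord.
by rewrite -big_split; apply: eq_bigr => i _; apply: bin_ffact_exchange.
Qed.

End Slices.

(** * Summing over the compositions *)

Theorem theorem2p4 (n k m : nat) (c : config) (hn : 0 < n) (hk : 0 < k) :
  #|placements n k c m| =
  \sum_(a <- compositions n k c m)
    \prod_(i < k) ('C(n - prev_part c a i, a i) * n ^_ (a i)).
Proof.
rewrite -sum1_card.
have memC A : A \in placements n k c m ->
    composition A \in compositions n k c m.
  by move=> PA; rewrite mem_undup; apply/imageP; exists A.
transitivity (\sum_(A in placements n k c m)
    \sum_(a <- compositions n k c m | composition A == a) 1).
  apply: eq_bigr => A /memC CA.
  by rewrite sum1_count (eq_count (a2 := pred1 (composition A)))
             ?count_uniq_mem ?undup_uniq ?CA // => a /=; rewrite eq_sym.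
rewrite (exchange_big_dep predT) //=.
rewrite !big_seq; apply: eq_bigr => a.
rewrite mem_undup => /imageP[A0 PA0 def_a].
rewrite -card_fixed_composition sum1dep_card; apply: eq_card => A.
rewrite !inE; case: (composition A =P a) => [CA | _]; rewrite ?andbF // !andbT.
(* The composition determines the number of rooks, so [a] already forces it to
   be [m]. *)
have -> : #|A| == m; last by rewrite andbT.
move: PA0; rewrite inE => /andP[_ /eqP <-].
by rewrite -!sum_composition CA def_a.
Qed.
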